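(* Let $(X,\mu)$ be an arbitrary probability space, let $Y$ be a finite set, let $\nu$ be a probability measure on $Y$ whose support is equal to $Y$, let $c:X\times Y\to\mathbb{R}$ be measurable, and let $\omega\in\mathbb{R}$. Then there exists a transport plan $\pi\in\Pi(\mu,\nu)$ with $\infty$-transport cost $\|c\|_{L^\infty(\pi)}\le\omega$ if and only if the $\omega$-transport graph $G_\omega$ has a perfect matching. Furthermore, if $\mu$ has no atoms and $G_\omega$ has a perfect matching, then such a transport plan can be taken to be induced by a transport map, i.e. there is a measurable map $T:X\to Y$ such that $(\mathrm{Id}\times T)_\#\mu\in\Pi(\mu,\nu)$ and $\|c\|_{L^\infty((\mathrm{Id}\times T)_\#\mu)}\le\omega$.
   Context: $Y$ carries the $\sigma$-algebra of all its subsets and $X\times Y$ the product $\sigma$-algebra. That the support of $\nu$ equals $Y$ means $\nu(\{y\})>0$ for all $y\in Y$. $\Pi(\mu,\nu)$ is the set of probability measures on $X\times Y$ with left marginal $\mu$ and right marginal $\nu$; its elements are called transport plans. The $\infty$-transport cost of $\pi\in\Pi(\mu,\nu)$ is $\|c\|_{L^\infty(\pi)}$, understood as the $\pi$-essential supremum of $c$ (not of $|c|$), so $\|c\|_{L^\infty(\pi)}\le\omega$ means $\pi(\{(x,y): c(x,y)>\omega\})=0$. For a measurable $T:X\to Y$, $(\mathrm{Id}\times T)_\#\mu$ denotes the push-forward of $\mu$ under $x\mapsto(x,T(x))$; if it lies in $\Pi(\mu,\nu)$, $T$ is called a transport map and the plan is said to be induced by $T$. An atom of $\mu$ is a measurable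 set $E$ with $\mu(E)>0$ such that every measurable $F\subset E$ has $\mu(F)\in\{0,\mu(E)\}$. For $A\subset Y$ put $$X_A:=\bigcap_{y\in A}\{x\in X: c(x,y)\le\omega\}\cap\bigcap_{y\in Y\setminus A}\{x\in X: c(x,y)>\omega\}.$$ The $\omega$-transport graph $G_\omega$ is the bipartite graph with left vertex set $L=2^Y$ (all subsets of $Y$, including $\emptyset$), right vertex set $R=Y$, an (unweighted) edge between $A\in L$ and $y\in R$ if and only if $y\in A$, and vertex weights $w(A)=\mu(X_A)$ for $A\in L$ and $w(y)=\nu(\{y\})$ for $y\in R$. A perfect matching of $G_\omega$ is a map $M:L\times R\to[0,\infty)$ such that $M(A,y)=0$ unless there is an edge between $A$ and $y$, $\sum_{y\in R}M(A,y)=w(A)$ for all $A\in L$, and $\sum_{A\in L}M(A,y)=w(y)$ for all $y\in R$. *)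

(* Defs.v *)
From HB Require Import structures.
From mathcomp Require Import all_boot all_order all_algebra.
From mathcomp Require Import all_classical all_reals all_analysis.
From mathcomp Require Import ess_sup_inf.

Set Implicit Arguments.
Unset Strict Implicit.
Unset Printing Implicit Defensive.

Import Order.TTheory GRing.Theory Num.Theory.
Local Open Scope classical_set_scope.
Local Open Scope ring_scope.
Local Open Scope ereal_scope.

Section transport.
Context (dX dY : measure_display) (X : measurableType dX)
  (Y : measurableType dY) (R : realType).

(* pi \in Pi(mu, nu). Marginals are compared on measurable sets only: the
   library's measures are set functions defined on all sets, but only their
   values on measurable sets are meaningful. *)
Definition transport_plan (mu : probability X R) (nu : probability Y R)
    (pi : probability (X * Y)%type R) : Prop :=
  (forall A : set X, measurable A -> pushforward pi fst A = mu A) /\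
  (forall B : set Y, measurable B -> pushforward pi snd B = nu B).

Definition infty_cost (pi : probability (X * Y)%type R) (c : X * Y -> R)
  : \bar R := ess_sup pi (fun p => (c p)%:E).

Definition graph_map (T : X -> Y) : X -> X * Y := fun x => (x, T x).

Lemma measurable_graph_map (T : {mfun X >-> Y}) :
  measurable_fun [set: X] (graph_map T).
Proof. by apply/measurable_fun_pair => //; exact: measurable_funPT. Qed.

(* This instance makes (Id x T)_# mu = distribution mu (graph_map T) a
   probability measure on X * Y. *)
HB.instance Definition _ (T : {mfun X >-> Y}) :=
  isMeasurableFun.Build _ _ _ _ (graph_map T) (measurable_graph_map T).

Definition induced_plan (mu : probability X R) (T : {mfun X >-> Y})
  : probability (X * Y)%type R := distribution mu (graph_map T).

Definition atom (mu : probability X R) (E : set X) : Prop :=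
  [/\ measurable E, 0 < mu E &
    forall F : set X, measurable F -> F `<=` E -> mu F = 0 \/ mu F = mu E].

End transport.

Record weighted_bigraph (R : realType) (L V : choiceType) := WeightedBigraph {
  edge : L -> V -> Prop;
  left_weight : L -> \bar R;
  right_weight : V -> \bar R }.

(* The sums are finitely supported sums over the whole vertex sets; they are
   meant for finite L and V (a sum with infinite support is 0 by convention). *)
Definition perfect_matching (R : realType) (L V : choiceType)
    (G : weighted_bigraph R L V) (M : L -> V -> R) : Prop :=
  [/\ forall a v, (0 <= M a v)%R,
      forall a v, ~ edge G a v -> M a v = 0%R,
      forall a, \sum_(v \in [set: V]) (M a v)%:E = left_weight G a &
      forall v, \sum_(a \in [set: L]) (M a v)%:E = right_weight G v].

Section transport_graph.
Context (dX dY : measure_display) (X : measurableType dX)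
  (Y : measurableType dY) (R : realType).

Definition sublevel_cell (c : X * Y -> R) (omega : R) (A : set Y) : set X :=
  \bigcap_(y in A) [set x | (c (x, y) <= omega)%R] `&`
  \bigcap_(y in ~` A) [set x | (omega < c (x, y))%R].

Definition transport_graph (mu : probability X R) (nu : probability Y R)
    (c : X * Y -> R) (omega : R) : weighted_bigraph R (set Y) Y :=
  {| edge := fun A y => A y;
     left_weight := fun A => mu (sublevel_cell c omega A);
     right_weight := fun y => nu [set y] |}.

End transport_graph.

(* Main.v *)
(** Only the set of the y with c(x, y) <= omega matters, so X splits into the
    finitely many cells X_A, and a plan has cost at most omega iff it gives
    measure 0 to X_A x {y} whenever y is not in A. Hence a plan pi yields the
    matching M(A, y) = pi(X_A x {y}); conversely a matching M yields the plan
    that spreads the mass M(A, y) over X_A x {y} proportionally to mu. When mu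
    has no atoms, Sierpinski's intermediate value theorem for measures cuts
    each X_A into pieces of measures M(A, y), and T sends such a piece to y. *)

From HB Require Import structures.
Require Import Defs.
From mathcomp Require Import all_boot all_order all_algebra.
From mathcomp Require Import all_classical all_reals all_analysis.
From mathcomp Require Import finmap lra measurable_realfun ess_sup_inf.
Import Order.TTheory GRing.Theory Num.Theory.
Import numFieldNormedType.Exports.

Local Open Scope classical_set_scope.
Local Open Scope ring_scope.
Local Open Scope ereal_scope.

Set Implicit Arguments.
Unset Strict Implicit.

(** * Finite sums of measures and finite partitions *)

Lemma finite_setT_set (T : choiceType) :
  finite_set [set: T] -> finite_set [set: set T].
Proof.
move=> fT.
have : finite_set
    ((fun A : {fset T} => [set` A]) @` [set` fpowerset (fset_set [set: T])]).
  exact: finite_image.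
apply: sub_finite_set => A _ /=.
have fA : finite_set A by apply: sub_finite_set fT.
exists (fset_set A); last exact: fset_setK.
by rewrite /= fpowersetE; apply/fsubsetP => y _; rewrite in_fset_set//; exact/mem_set.
Qed.

(** Serves to build a coupling as a sum of pieces: [measure_add] is binary, so the sum is formed by
    induction on an enumeration of [D]. *)
Lemma fsum_measure d (T : measurableType d) (R : realType) (I : choiceType)
    (D : set I) (m : I -> {measure set T -> \bar R}) : finite_set D ->
  exists m' : {measure set T -> \bar R},
    forall S, m' S = \sum_(i \in D) m i S.
Proof.
move=> fD.
suff H (s : seq I) : exists m' : {measure set T -> \bar R},
    forall S, m' S = \sum_(i <- s) m i S.
  have [m' m'E] := H (fset_set D).
  by exists m' => S; rewrite m'E fsbig_finite.
elim: s => [|i s [m' m'E]].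
  by exists mzero => S; rewrite big_nil.
exists (measure_add (m i) m') => S.
by rewrite big_cons -m'E; exact: measure_addE.
Qed.

(** The partition is given as the fibres of a map, so that disjointness and covering are automatic;
    only finiteness and measurability remain to be checked. *)
Lemma measure_partition d (T : measurableType d) (R : realType)
    (mu : {measure set T -> \bar R}) (I : choiceType) (f : T -> I) (S : set T) :
  finite_set [set: I] -> (forall i, measurable (f @^-1` [set i])) ->
  measurable S ->
  mu S = \sum_(i \in [set: I]) mu (S `&` f @^-1` [set i]).
Proof.
move=> fI mf mS; rewrite -measure_fin_bigcup //.
- by congr (mu _); rewrite -setI_bigcupr -preimage_bigcup bigcup_imset1 image_id setIT.
- exact: trivIset_preimage1_in.
- by move=> i _; exact: measurableI.
Qed.

(** * Sierpinski's intermediate value theorem *)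

(** As [E] is not an atom, some measurable [F] inside it has measure neither 0 nor that of [E]; the
    smaller of [F] and its complement in [E] will do. *)
Lemma half_subset d (T : measurableType d) (R : realType)
    (mu : probability T R) (E : set T) :
  (forall F, ~ atom mu F) -> measurable E -> 0 < mu E ->
  exists F, [/\ measurable F, F `<=` E, 0 < mu F &
    (fine (mu F) <= fine (mu E) / 2)%R].
Proof.
move=> natom mE E0.
have [F [mF FE F0 FE']] : exists F, [/\ measurable F, F `<=` E, mu F <> 0 & mu F <> mu E].
  apply/not_existsP => H; apply: (natom E); split=> // F mF FE.
  by apply: contrapT => /not_orP[F0 F1]; apply: (H F).
have mEF : measurable (E `\` F) by exact: measurableD.
have EE : mu E = mu F + mu (E `\` F).
  by rewrite -measureU// ?setDUK// setDIK.
have F_gt0 : 0 < mu F by rewrite lt0e measure_ge0 andbT; apply/eqP.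
have EF_gt0 : 0 < mu (E `\` F).
  rewrite lt0e measure_ge0 andbT; apply/eqP => EF0.
  by apply: FE'; rewrite EE EF0 adde0.
have fEE : fine (mu E) = (fine (mu F) + fine (mu (E `\` F)))%R.
  by rewrite EE fineD// fin_num_measure.
have [le|le] := leP (fine (mu F)) (fine (mu E) / 2)%R.
  by exists F.
exists (E `\` F); split => //; lra.
Qed.

(** Iterated halving: the bound on the measure decays geometrically. *)
Lemma small_subset d (T : measurableType d) (R : realType)
    (mu : probability T R) (E : set T) (e : R) :
  (forall F, ~ atom mu F) -> measurable E -> 0 < mu E -> (0 < e)%R ->
  exists F, [/\ measurable F, F `<=` E, 0 < mu F & (fine (mu F) < e)%R].
Proof.
move=> natom mE E0 e0.
have H n : exists F, [/\ measurable F, F `<=` E, 0 < mu F &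
    (fine (mu F) <= fine (mu E) / 2 ^+ n)%R].
  elim: n => [|n [F [mF FE F0 Fn]]].
    by exists E; split; rewrite // expr0 divr1.
  have [G [mG GF G0 Gn]] := half_subset natom mF F0.
  exists G; split => //; first exact: (subset_trans GF FE).
  apply: (le_trans Gn); rewrite exprSr invfM mulrA.
  by rewrite ler_pM2r ?invr_gt0.
have [n] : exists n, (fine (mu E) / 2 ^+ n < e)%R.
  have : (fine (mu E) / 2 ^+ n)%R @[n --> \oo] --> (0%R : R).
    rewrite -(mulr0 (fine (mu E))); apply: cvgMr.
    under eq_fun do rewrite -exprVn.
    by apply: cvg_expr; rewrite ger0_norm; lra.
  move=> /cvgrPdist_lt /(_ _ e0)[n _ /(_ n (leqnn n))].
  rewrite sub0r normrN => /= lt; exists n.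
  by apply: le_lt_trans lt; exact: ler_norm.
move=> lt; have [F [mF FE F0 Fn]] := H n.
by exists F; split => //; exact: le_lt_trans lt.
Qed.

(** Sierpinski's theorem by countable exhaustion: the union [U] of a greedily chosen increasing
    sequence of subsets of measure at most [t] has measure exactly [t]. *)
Lemma atomless_intermediate d (T : measurableType d) (R : realType)
    (mu : probability T R) (E : set T) (t : R) :
  (forall F, ~ atom mu F) -> measurable E -> (0 <= t)%R -> t%:E <= mu E ->
  exists F, [/\ measurable F, F `<=` E & mu F = t%:E].
Proof.
move=> natom mE t0 tE.
pose m S := fine (mu S).
have mK S : measurable S -> mu S = (m S)%:E.
  by move=> mS; rewrite fineK// fin_num_measure.
have m_diff F G : measurable F -> measurable G -> F `<=` G ->
    m G = (m F + m (G `\` F))%R.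
  move=> mF mG FG; apply: EFin_inj; rewrite EFinD -!mK//; last exact: measurableD.
  by rewrite -measureU// ?setDUK// ?setDIK//; exact: measurableD.
pose P F := [/\ measurable F, F `<=` E & (m F <= t)%R].
have mW F : P F -> measurable F by case.
have P0 : P set0 by split => //; rewrite /m measure0.
(* Greedy enlargement: each step gains at least half of what is possible. *)
have step (F : {F | P F}) : exists G : {G | P G}, sval F `<=` sval G /\
    forall H, P H -> sval F `<=` H ->
      (m H - m (sval F) <= 2 * (m (sval G) - m (sval F)))%R.
  case: F => F PF /=.
  pose A := [set m G | G in [set G | P G /\ F `<=` G]].
  have inA G : P G -> F `<=` G -> A (m G) by exists G.
  have A0 : A !=set0 by exists (m F); exact: inA.
  have ubA : has_ubound A by exists t => _ [G [[_ _ Gt] _] <-].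
  have FA : (m F <= sup A)%R by apply: ub_le_sup => //; exact: inA.
  (* If the supremum is already attained at [F], take [G] to be [F]. Otherwise take [G] within half
     the gap of the supremum, so that it gains more than half of [sup A - m F]. *)
  have [eq|lt] := eqVneq (sup A) (m F).
    exists (exist _ F PF); split => //= H PH FH; rewrite subrr mulr0 subr_le0 -eq.
    by apply: ub_le_sup => //; exact: inA.
  have {}lt : (m F < sup A)%R by rewrite lt_def lt.
  have [|_ [G [PG FG] <-] Glt] := @sup_adherent _ A ((sup A - m F) / 2)%R _ (conj A0 ubA).
    by rewrite divr_gt0// subr_gt0.
  exists (exist _ G PG); split => //= H PH FH.
  have : (m H <= sup A)%R by apply: ub_le_sup => //; exact: inA.
  lra.
have [g gP] := choice step.
pose F n : set T := sval (iter n g (exist _ _ P0)).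
have PF n : P (F n) by exact: svalP.
have FS n : F n `<=` F n.+1 by have [] := gP (iter n g (exist _ _ P0)).
have Fhalf n H : P H -> F n `<=` H -> (m H - m (F n) <= 2 * (m (F n.+1) - m (F n)))%R.
  by have [_] := gP (iter n g (exist _ _ P0)); exact.
have Fnd : {homo F : n k / (n <= k)%N >-> (n <= k)%O}.
  by apply/nondecreasing_seqP => n; apply/subsetPset.
pose U := \bigcup_n F n.
have mF n : measurable (F n) by exact: mW.
have mU : measurable U by exact: bigcup_measurable.
have cvU : m (F n) @[n --> \oo] --> m U.
  apply: fine_cvg; rewrite -mK//.
  exact: nondecreasing_cvg_mu.
have PU : P U.
  split => //; first by apply: bigcup_sub => n _; have [] := PF n.
  apply: cvgr_to_le cvU _.
  by apply: nearW => n; have [] := PF n.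
exists U; split => //; first by have [] := PU.
(* If m U < t, a subset H of E \ U of small positive measure could be added at
   every step, although the gains tend to 0. *)
rewrite mK//; congr _%:E; apply/eqP; rewrite eq_le.
apply/andP; split; first by have [] := PU.
rewrite leNgt; apply/negP => Ut.
have UE : U `<=` E by have [] := PU.
have mEU : measurable (E `\` U) by exact: measurableD.
have [||H [mH HEU H0 Hlt]] := @small_subset _ _ _ mu (E `\` U) (t - m U)%R natom mEU.
- rewrite mK// lte_fin; move: tE; rewrite mK// lee_fin (m_diff U E)//; lra.
- by rewrite subr_gt0.
have UHD : (U `|` H) `\` U = H.
  by rewrite setDUl setDv set0U; apply: setDidl; apply/seteqP; split => // x [/HEU[]].
have mUH : measurable (U `|` H) by exact: measurableU.
have UHE : m (U `|` H) = (m U + m H)%R.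
  by rewrite (m_diff U)// UHD.
have PUH : P (U `|` H).
  split => //; first by rewrite subUset; split => // x /HEU[].
  by rewrite UHE -/(m H) in Hlt *; lra.
have Hpos : (0 < m H)%R by rewrite -lte_fin -mK.
have cvU' : m (F n.+1) @[n --> \oo] --> m U by rewrite (cvg_shiftS (fun n => m (F n))).
(* This is the limit in [n] of [Fhalf n] applied to the union of [U] and [H]; it forces
   [m H <= 0]. *)
have : (m U + m H - m U <= 2 * (m U - m U))%R.
  apply: (ler_cvg_to (cvgB (cvg_cst (m U + m H)%R) cvU) (cvgMr (cvgB cvU' cvU))).
  apply: nearW => n; rewrite -UHE; apply: Fhalf => //.
    by apply: subset_trans (@subsetUl _ _ _); exact: bigcup_sup.
lra.
Qed.

(** * Maps and couplings with prescribed masses *)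

Lemma pushforward_measure d d' (T : measurableType d) (T' : measurableType d')
    (R : realType) (m : {measure set T -> \bar R}) (f : T -> T') :
  measurable_fun [set: T] f ->
  exists m' : {measure set T' -> \bar R}, forall S, m' S = m (f @^-1` S).
Proof.
by move=> mf; unshelve eexists [the {measure set T' -> \bar R} of pushforward m f].
Qed.

Lemma exists_probability d (T : measurableType d) (R : realType)
    (m : {measure set T -> \bar R}) :
  m [set: T] = 1 -> exists P : probability T R, forall S, P S = m S.
Proof.
(* [mnormalize] only uses its second measure when [m setT] is 0 or +oo. *)
move=> mT; exists (mnormalize m (dirac point)) => S /=.
by rewrite /mnormalize mT eqe oner_eq0/= invr1 mule1.
Qed.

(** Induction on [s]: Sierpinski's theorem cuts a piece of measure [w y] off [E], which is sent to
    [y], and the rest of [E] is split among the remaining points. [T] is total, but its values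
    outside [E] do not matter. *)
Lemma atomless_split d d' (X : measurableType d) (Y : measurableType d')
    (R : realType) (mu : probability X R) (w : Y -> R) (s : seq Y) (E : set X) :
  (forall F, ~ atom mu F) -> (forall B : set Y, measurable B) ->
  (forall y, 0 <= w y)%R -> uniq s -> measurable E ->
  mu E = \sum_(y <- s) (w y)%:E ->
  exists T : X -> Y, measurable_fun [set: X] T /\
    forall y, mu (E `&` T @^-1` [set y]) = if y \in s then (w y)%:E else 0.
Proof.
move=> natom dY w0; elim: s E => [|y s IH] E.
  (* With no points left [E] is a null set, so any measurable map works. *)
  rewrite big_nil => _ mE E0; exists (cst point); split => // y.
  apply: subset_measure0 E0 => //; apply: measurableI => //.
  by rewrite -[X in measurable X]setTI; exact: measurable_cst.
move=> /= /andP[ys us] mE; rewrite big_cons => muE.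
have [|F [mF FE muF]] := atomless_intermediate natom mE (w0 y).
  by rewrite muE leeDl// sume_ge0// => z _; rewrite lee_fin.
have mEF : measurable (E `\` F) by exact: measurableD.
have [|T [mT TE]] := IH _ us mEF.
  have : mu E = mu F + mu (E `\` F) by rewrite -measureU// ?setDUK// setDIK.
  rewrite muF muE !(addeC (w y)%:E) => /(congr1 (fun x => x - (w y)%:E)).
  by rewrite /= !addeK.
pose T' x := if x \in F then y else T x.
have T'F x : F x -> T' x = y by move=> Fx; rewrite /T' mem_set.
have T'NF x : ~ F x -> T' x = T x by move=> Fx; rewrite /T' memNset.
have mT' : measurable_fun [set: X] T'.
  apply: measurable_fun_if => //.
    by apply: measurable_fun_bool; rewrite setTI (_ : _ @^-1` _ = F)//;
      apply/seteqP; split => x /=; [exact: set_mem|exact: mem_set].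
  exact: measurable_funS mT.
exists T'; split => // z.
have mET' : measurable (E `&` T' @^-1` [set z]).
  by apply: measurableI => //; rewrite -[X in measurable X]setTI; exact: mT'.
have -> : mu (E `&` T' @^-1` [set z]) =
    mu ((E `\` F) `&` T @^-1` [set z]) + mu (E `&` T' @^-1` [set z] `&` F).
  rewrite (measureDI mu mET' mF); congr (mu _ + _).
  apply/seteqP; split => x /=.
    by move=> [[Ex T'x] Fx]; rewrite -T'NF.
  by move=> [[Ex Fx] Tx]; rewrite T'NF.
(* For [z = y], the part outside [F] is null because [y] does not occur in [s], and [F] contributes
   [w y]. For other [z], the fibre of [T'] misses [F]. *)
rewrite TE in_cons; have [->|zy] := eqVneq z y.
  rewrite (negbTE ys) add0e -muF; congr (mu _).
  apply/seteqP; split => x /=; first by case.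
  by move=> Fx; split => //; split; [exact: FE | exact: T'F].
rewrite (_ : _ `&` F = set0) ?measure0 ?adde0//.
apply/seteqP; split => // x /= [[_ T'x] Fx].
by move: zy; rewrite -T'x T'F// eqxx.
Qed.

(** Each fibre of [f] is split on its own, and the maps so obtained are glued as [T (f x) x]; the
    result is measurable because there are finitely many fibres. *)
Lemma atomless_map d d' (X : measurableType d) (Y : measurableType d')
    (R : realType) (mu : probability X R) (I : choiceType) (f : X -> I)
    (M : I -> Y -> R) :
  (forall F, ~ atom mu F) ->
  finite_set [set: I] -> (forall i, measurable (f @^-1` [set i])) ->
  finite_set [set: Y] -> (forall B : set Y, measurable B) ->
  (forall i y, 0 <= M i y)%R ->
  (forall i, \sum_(y \in [set: Y]) (M i y)%:E = mu (f @^-1` [set i])) ->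
  exists T : {mfun X >-> Y}, forall i y,
    mu (f @^-1` [set i] `&` T @^-1` [set y]) = (M i y)%:E.
Proof.
move=> natom fI mf fY dY M0 ME.
have /choice[T TP] i : exists T : X -> Y, measurable_fun [set: X] T /\
    forall y, mu (f @^-1` [set i] `&` T @^-1` [set y]) = (M i y)%:E.
  have [||T [mT TE]] := @atomless_split _ _ _ _ _ mu (M i) (fset_set [set: Y])
    _ natom dY (M0 i) _ (mf i).
  - exact: fset_uniq.
  - by rewrite -ME fsbig_finite.
  exists T; split => // y; rewrite TE in_fset_set// mem_set//.
pose T0 x := T (f x) x.
have mT0 : measurable_fun [set: X] T0.
  move=> _ B mB; rewrite setTI.
  rewrite (_ : _ @^-1` _ = \bigcup_i (f @^-1` [set i] `&` T i @^-1` B)).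
    apply: fin_bigcup_measurable => // i _; apply: measurableI => //.
    by rewrite -[X in measurable X]setTI; apply: (proj1 (TP i)).
  apply/seteqP; split => x /=; first by exists (f x).
  by move=> [i _ [/= <-]].
pose T1 : {mfun X >-> Y} := HB.pack T0 (isMeasurableFun.Build _ _ _ _ T0 mT0).
exists T1 => i y; rewrite -(proj2 (TP i)); congr (mu _).
by apply/seteqP; split => x /= [fx]; rewrite /T0 /= fx.
Qed.

(** Reduces the second marginal to singletons, where it is a column sum of the matching. *)
Lemma eq_marginal_discrete d d' (T : measurableType d) (Y : measurableType d')
    (R : realType) (m : {measure set T -> \bar R}) (nu : {measure set Y -> \bar R})
    (f : T -> Y) (B : set Y) :
  finite_set [set: Y] -> (forall B : set Y, measurable B) ->
  measurable_fun [set: T] f ->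
  (forall y, m (f @^-1` [set y]) = nu [set y]) -> m (f @^-1` B) = nu B.
Proof.
move=> fY dY mf mE.
have mfB (C : set Y) : measurable (f @^-1` C).
  by rewrite -[X in measurable X]setTI; exact: mf.
rewrite (measure_partition _ fY (fun y => mfB [set y]))//.
rewrite [RHS](@measure_partition _ _ _ nu _ id)//.
apply: eq_fsbigr => y _ /=; rewrite preimage_id -preimage_setI.
have [By|By] := pselect (B y).
  rewrite (_ : B `&` [set y] = [set y])//.
  by apply/seteqP; split => // z ->.
rewrite (_ : B `&` [set y] = set0) ?preimage_set0 ?measure0//.
by apply/seteqP; split => // z /= [Bz zy]; apply: By; rewrite -zy.
Qed.

(** The coupling is the sum over [i] and [y] of [M i y / w i] times the product of [mu] restricted
    to the fibre over [i] with the Dirac mass at [y]. Each such product is obtained as a pushforward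
    under [x] to [(x, y)]. *)
Lemma exists_coupling d d' (X : measurableType d) (Y : measurableType d')
    (R : realType) (mu : probability X R) (nu : probability Y R)
    (I : choiceType) (f : X -> I) (M : I -> Y -> R) :
  finite_set [set: I] -> (forall i, measurable (f @^-1` [set i])) ->
  finite_set [set: Y] -> (forall B : set Y, measurable B) ->
  (forall i y, 0 <= M i y)%R ->
  (forall i, \sum_(y \in [set: Y]) (M i y)%:E = mu (f @^-1` [set i])) ->
  (forall y, \sum_(i \in [set: I]) (M i y)%:E = nu [set y]) ->
  exists pi : probability (X * Y)%type R, transport_plan mu nu pi /\
    forall i y, pi (f @^-1` [set i] `*` [set y]) = (M i y)%:E.
Proof.
move=> fI mf fY dY M0 Mmu Mnu.
pose w i := fine (mu (f @^-1` [set i])).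
have wE i : mu (f @^-1` [set i]) = (w i)%:E by rewrite fineK// fin_num_measure.
have w0 i : (0 <= w i)%R by exact: fine_ge0.
have k0 i y : (0 <= M i y / w i)%R by rewrite divr_ge0.
(* On a null fibre the quotient [M i y / w i] is 0 by the convention on division; this is harmless
   since the row of [M] vanishes too. *)
have M_w0 i y : w i = 0%R -> M i y = 0%R.
  move=> wi0; apply: EFin_inj.
  apply: (@pfsume_eq0 _ _ [set: Y] (fun y => (M i y)%:E)) => //.
    by move=> z _; rewrite lee_fin.
  by rewrite Mmu wE wi0.
have /choice[m mE] (p : Y * I) : exists m : {measure set (X * Y) -> \bar R}, forall S,
    m S = (M p.2 p.1 / w p.2)%:E * mu ((pair^~ p.1) @^-1` S `&` f @^-1` [set p.2]).
  case: p => y i /=.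
  have [m mE] := @pushforward_measure _ _ _ _ _ (mrestr mu (mf i)) (pair^~ y)
    (@pair2_measurable _ _ X Y y).
  by exists (mscale (NngNum (k0 i y)) m) => S; rewrite /= /mscale/= mE.
have [pi piE] := fsum_measure m (finite_setX fY fI).
have {}piE S : pi S = \sum_(y \in [set: Y]) \sum_(i \in [set: I])
    (M i y / w i)%:E * mu ((pair^~ y) @^-1` S `&` f @^-1` [set i]).
  rewrite piE pair_fsbig//; exact: eq_fsbigr.
have pi1 A : measurable A -> pi (A `*` [set: Y]) = mu A.
  move=> mA.
  have -> : mu A = \sum_(i \in [set: I]) mu (A `&` f @^-1` [set i]).
    exact: measure_partition.
  rewrite piE exchange_fsbig//.
  apply: eq_fsbigr => i _.
  have AE y : pair^~ y @^-1` (A `*` [set: Y]) = A.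
    by apply/seteqP; split => x /=; [case|].
  under eq_fsbigr do rewrite AE.
  have [wi0|wi0] := eqVneq (w i) 0%R.
    have fi0 : mu (f @^-1` [set i]) = 0 by rewrite wE wi0.
    have Ai0 : mu (A `&` f @^-1` [set i]) = 0.
      by apply: subset_measure0 fi0 => //; exact: measurableI.
    by rewrite Ai0; apply: fsbig1 => y _; rewrite mule0.
  have -> : mu (A `&` f @^-1` [set i]) = (fine (mu (A `&` f @^-1` [set i])))%:E.
    by rewrite fineK// fin_num_measure//; exact: measurableI.
  (* The factor independent of [y], the measure of the part of [A] in the fibre divided by [w i], is
     moved to the front; the row sum [w i] then cancels the denominator. *)
  under eq_fsbigr do rewrite -EFinM mulrAC -mulrA mulrC EFinM.
  rewrite -ge0_mule_fsumr//; last by move=> y; rewrite lee_fin.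
  rewrite Mmu wE -EFinM divfK//.
have piT : pi [set: X * Y] = 1 by rewrite -setXTT pi1// probability_setT.
have piM i y : pi (f @^-1` [set i] `*` [set y]) = (M i y)%:E.
  (* Only the summand for [y] and [i] charges this rectangle: distinct fibres of [f] are disjoint,
     and the section at any other point of [Y] is empty. *)
  rewrite piE (fsbigD1 y)//= (fsbigD1 i)//=.
  rewrite fsbig1 ?adde0; last first.
    move=> j [_ ji].
    rewrite (_ : _ `&` _ = set0) ?measure0 ?mule0//.
    by apply/seteqP; split => // x /= [[fi _] fj]; apply: ji; rewrite /= -fi -fj.
  rewrite fsbig1 ?adde0; last first.
    move=> z [_ zy]; apply: fsbig1 => j _.
    rewrite (_ : _ `&` _ = set0) ?measure0 ?mule0//.
    by apply/seteqP; split => // x /= [[_ zy']].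
  rewrite (_ : _ `&` _ = f @^-1` [set i]).
    rewrite wE -EFinM; have [wi0|wi0] := eqVneq (w i) 0%R.
      by rewrite wi0 mulr0 M_w0.
    by rewrite divfK.
  by apply/seteqP; split => x /=; [case|].
have [P PE] := exists_probability piT.
exists P; split; last by move=> i y; rewrite PE.
split => [A mA|B _]; rewrite /pushforward PE.
  by rewrite -pi1//; congr (pi _); apply/seteqP; split => -[x y] /=; [|case].
apply: (@eq_marginal_discrete _ _ _ _ _ pi nu snd) => //.
(* Cutting the preimage of [y] along the fibres of [f] gives the column sum at [y]. *)
move=> y; apply: etrans (Mnu y); rewrite (@measure_partition _ _ _ pi _ (f \o fst))//.
- by apply: eq_fsbigr => i _; rewrite -piM; congr (pi _);
    apply/seteqP; split => -[x z] /= [].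
- move=> i; rewrite comp_preimage -[X in measurable X]setTI.
  exact: measurable_fst.
- by rewrite -[X in measurable X]setTI; exact: measurable_snd.
Qed.

(** * The cells and the cost bound *)

(** The cells X_A are the fibres of this map into [set Y], so the lemmas on fibres apply to them. *)
Definition sublevel d d' (X : measurableType d) (Y : measurableType d')
    (R : realType) (c : X * Y -> R) (omega : R) (x : X) : set Y :=
  [set y | (c (x, y) <= omega)%R].

Lemma sublevel_cellE d d' (X : measurableType d) (Y : measurableType d')
    (R : realType) (c : X * Y -> R) (omega : R) (A : set Y) :
  sublevel_cell c omega A = sublevel c omega @^-1` [set A].
Proof.
apply/seteqP; split => x /=.
  move=> [xA xNA]; apply/seteqP; split => y /=; last exact: xA.
  by apply: contraPP => /xNA/=; rewrite ltNge => /negP.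
move=> <-; split => y //= /negP.
by rewrite -ltNge.
Qed.

Lemma measurable_sublevel_cell d d' (X : measurableType d) (Y : measurableType d')
    (R : realType) (c : X * Y -> R) (omega : R) (A : set Y) :
  finite_set [set: Y] -> measurable_fun [set: X * Y] c ->
  measurable (sublevel_cell c omega A).
Proof.
move=> fY mc.
have mcy y (B : set R) : measurable B -> measurable [set x | B (c (x, y))].
  by move=> mB; rewrite -[X in measurable X]setTI; exact: (measurable_fun_pair1 y mc).
have fA (B : set Y) : finite_set B by exact: sub_finite_set fY.
apply: measurableI; apply: fin_bigcap_measurable => // y _.
- have := mcy y _ (measurable_itv `]-oo, omega]).
  by congr measurable; apply/seteqP; split => x /=; rewrite in_itv.
- have := mcy y _ (measurable_itv `]omega, +oo[).
  by congr measurable; apply/seteqP; split => x /=; rewrite in_itv/= andbT.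
Qed.

(** The set where [c] exceeds [omega] is the finite union of the rectangles X_A x {y} with [y]
    outside [A], so it is null iff each of them is. *)
Lemma infty_cost_leP d d' (X : measurableType d) (Y : measurableType d')
    (R : realType) (pi : probability (X * Y)%type R) (c : X * Y -> R) (omega : R) :
  finite_set [set: Y] -> (forall B : set Y, measurable B) ->
  measurable_fun [set: X * Y] c ->
  infty_cost pi c <= omega%:E <->
  forall (A : set Y) (y : Y), ~ A y -> pi (sublevel_cell c omega A `*` [set y]) = 0.
Proof.
move=> fY dY mc.
have mAy (A : set Y) (y : Y) : measurable (sublevel_cell c omega A `*` [set y]).
  by apply: measurableX => //; exact: measurable_sublevel_cell.
have mcE : measurable_fun [set: X * Y] (fun p => (c p)%:E : \bar R).
  exact/measurable_EFinP.
set S := (fun p => (c p)%:E) @^-1` `]omega%:E, +oo[.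
have mS : measurable S.
  by rewrite -[X in measurable X]setTI; apply: mcE => //; exact: emeasurable_itv.
have SE p : S p <-> ~ sublevel c omega p.1 p.2.
  case: p => x y; rewrite /S /sublevel /= in_itv/= andbT lte_fin ltNge.
  by split => /negP.
have -> : infty_cost pi c <= omega%:E <-> pi S = 0.
  rewrite -(ae_le_measureP pi omega%:E mcE).
  by split => [/ess_supP//|?]; exact/ess_supP.
split => [S0 A y Ay|H].
  apply: subset_measure0 S0 => // -[x z] /=.
  by rewrite sublevel_cellE => -[/= xA zy]; apply/SE; rewrite /= xA zy.
(* The fibres of [f] are all the rectangles X_A x {y}; those with [y] in [A] do not meet [S]. *)
pose f (p : X * Y) := (sublevel c omega p.1, p.2).
have fE A y : f @^-1` [set (A, y)] = sublevel_cell c omega A `*` [set y].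
  rewrite sublevel_cellE; apply/seteqP; split => -[x z] /=.
    by move=> [<- <-].
  by move=> [<- ->].
rewrite (@measure_partition _ _ _ pi _ f)//.
- apply: fsbig1 => -[A y] _; rewrite fE.
  have [Ay|Ay] := pselect (A y).
    rewrite (_ : _ `&` _ = set0) ?measure0//.
    apply/seteqP; split => // -[x z] /= [/SE/= xz].
    by rewrite sublevel_cellE => -[/= xA zy]; apply: xz; rewrite xA zy.
  apply: subset_measure0 (H _ _ Ay) => //; first exact: measurableI.
- rewrite -setXTT; apply: finite_setX => //; exact: finite_setT_set.
- by move=> [A y]; rewrite fE.
Qed.

(** * Plans, matchings and transport maps *)

Unset Implicit Arguments.

Theorem theorem1p5 (R : realType) (dX dY : measure_display)
    (X : measurableType dX) (mu : probability X R)
    (Y : measurableType dY)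
    (finY : finite_set [set: Y])
    (discreteY : forall B : set Y, measurable B)
    (nu : probability Y R)
    (supp_nu : forall y : Y, 0 < nu [set y])
    (c : X * Y -> R) (mc : measurable_fun [set: X * Y] c)
    (omega : R) :
  ((exists pi : probability (X * Y)%type R,
      transport_plan mu nu pi /\ infty_cost pi c <= omega%:E)
   <-> (exists M : set Y -> Y -> R,
      perfect_matching (transport_graph mu nu c omega) M))
  /\
  ((forall E : set X, ~ atom mu E) ->
   (exists M : set Y -> Y -> R,
      perfect_matching (transport_graph mu nu c omega) M) ->
   exists T : {mfun X >-> Y},
     transport_plan mu nu (induced_plan mu T) /\
     infty_cost (induced_plan mu T) c <= omega%:E).
Proof.
have fS : finite_set [set: set Y] by exact: finite_setT_set.
have mcell A : measurable (sublevel c omega @^-1` [set A]).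
  by rewrite -sublevel_cellE; exact: measurable_sublevel_cell.
split; first split.
- move=> [pi [[pi_mu pi_nu] /infty_cost_leP pi_cost]].
  have mAy (A : set Y) (y : Y) : measurable (sublevel_cell c omega A `*` [set y]).
    by apply: measurableX => //; exact: measurable_sublevel_cell.
  have msnd y : measurable (snd @^-1` [set y] : set (X * Y)).
    by rewrite -[X in measurable X]setTI; exact: measurable_snd.
  have mfst A : measurable (fst @^-1` sublevel_cell c omega A : set (X * Y)).
    rewrite -[X in measurable X]setTI sublevel_cellE.
    exact: measurable_fst.
  have ME A y : (fine (pi (sublevel_cell c omega A `*` [set y])))%:E =
      pi (sublevel_cell c omega A `*` [set y]).
    by rewrite fineK// fin_num_measure.
  exists (fun A y => fine (pi (sublevel_cell c omega A `*` [set y]))).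
  split => [A y|A y /= Ay|A|y] /=.
  + exact: fine_ge0.
  + by rewrite pi_cost.
  + under eq_fsbigr do rewrite ME.
    rewrite -pi_mu; last exact: measurable_sublevel_cell.
    (* Row sums: cutting X_A x Y along [snd] gives the rectangles X_A x {y} up to conversion. Column
       sums cut along the cells instead. *)
    rewrite /pushforward [RHS](@measure_partition _ _ _ pi _ snd)//.
  + under eq_fsbigr do rewrite ME.
    rewrite -pi_nu// /pushforward.
    rewrite [RHS](@measure_partition _ _ _ pi _ (sublevel c omega \o fst))//.
      apply: eq_fsbigr => A _; rewrite sublevel_cellE; congr (pi _).
      by apply/seteqP; split => -[x z] /= [].
    by move=> A; rewrite comp_preimage -sublevel_cellE.
- move=> [M [M0 MN Mmu Mnu]].
  have [||pi [pi_plan piM]] :=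
    @exists_coupling _ _ _ _ _ mu nu _ (sublevel c omega) M
      fS mcell finY discreteY M0.
  + by move=> A; rewrite -sublevel_cellE Mmu.
  + by move=> y; rewrite Mnu.
  exists pi; split => //; apply/infty_cost_leP => // A y Ay.
  by rewrite sublevel_cellE piM MN.
- move=> natom [M [M0 MN Mmu Mnu]].
  have [|T TM] := @atomless_map _ _ _ _ _ mu _ (sublevel c omega) M
    natom fS mcell finY discreteY M0.
    by move=> A; rewrite -sublevel_cellE Mmu.
  exists T; split; last first.
    apply/infty_cost_leP => // A y Ay.
    rewrite sublevel_cellE.
    (* By conversion, the induced plan gives a rectangle the [mu]-measure of its preimage under the
       graph map. *)
    rewrite -[LHS]/(mu (sublevel c omega @^-1` [set A] `&` T @^-1` [set y])).
    by rewrite TM MN.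
  (* The first marginal holds by conversion, since [fst] after the graph map is the identity. *)
  split => [A mA|B _] //.
  rewrite -[LHS]/(mu (T @^-1` B)).
  apply: eq_marginal_discrete => // y.
  apply: etrans (Mnu y).
  rewrite [LHS](@measure_partition _ _ _ mu _ (sublevel c omega))//.
    by apply: eq_fsbigr => A _; rewrite -TM setIC.
  by rewrite -[X in measurable X]setTI; exact: measurable_funPT.
Qed.
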